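(* Let $\mathbb{T}^n$ be the $n$-dimensional torus. Then $$\operatorname{AF}(\mathbb{T}^n) = N(\operatorname{AF}(\mathbb{T}^n)) = E_{\mathbb{T}^n}(\operatorname{AF}(\mathbb{T}^n)).$$
   Context: $\mathbb{T}$ is the unit circle group (equivalently $\mathbb{R}/\mathbb{Z}$) and $\mathbb{T}^n$ is the product of $n$ copies of it. For a compact group $G$: $\operatorname{Homeo}(G)$ is the set of all homeomorphisms $G \to G$; $L_x : G \to G$ is left translation by $x \in G$; $\operatorname{Aut}(G)$ is the set of all maps $G \to G$ that are both homeomorphisms and group automorphisms; $\operatorname{AF}(G) = \{L_x \circ \varphi : x \in G,\ \varphi \in \operatorname{Aut}(G)\}$ is the set of affine maps of $G$. For a set $P$ of Haar-measure-preserving homeomorphisms of $G$, $$N(P) = \{ f \in \operatorname{Homeo}(G) : fP \subseteq Pf \},$$ where $fP = \{f\circ p : p \in P\}$ and $Pf = \{p \circ f : p \in P\}$, and the translation normalizer of $P$ is $$E_G(P) = \{ f \in \operatorname{Homeo}(G) : \text{for every } x \in G \text{ there is } p \in P \text{ with } f \circ L_x = p \circ f \}.$$ *)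

(* Defs.v *)
From HB Require Import structures.
From mathcomp Require Import all_boot all_order all_algebra.
From mathcomp Require Import all_classical all_reals topology normedtype.

Set Implicit Arguments.
Unset Strict Implicit.
Unset Printing Implicit Defensive.

Import Order.TTheory GRing.Theory Num.Theory.
Import numFieldNormedType.Exports.

Local Open Scope classical_set_scope.
Local Open Scope ring_scope.

Definition integers (R : realType) : zmodClosed R :=
  GRing.ZmodClosed.clone R (@Num.int_num_subdef R) _.

Lemma integersE (R : realType) (x : R) : (x \in integers R) = (x \is a Num.int).
Proof. by []. Qed.

Definition circle (R : realType) : Type :=
  quotient_topology (Quotient.quot (integers R)).

Section Circle.
Context {R : realType}.
Local Notation Q := (Quotient.quot (integers R)).

HB.instance Definition _ := Topological.on (circle R).
(* Not a copy of the Zmodule structure of Q: quotient_topology carries its own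
   choice structure, which differs from that of Q. *)
HB.instance Definition _ := GRing.isZmodule.Build (circle R)
  (@addrA Q) (@addrC Q) (@add0r Q) (@addNr Q).

Definition circle_pi (x : R) : circle R := \pi_Q%qT x.

Lemma circle_piB : {morph circle_pi : x y / x - y}.
Proof. exact: (raddfB (\pi_Q%qT : {additive R -> Q})). Qed.

Lemma circle_pi_surj (a : circle R) : exists x, a = circle_pi x.
Proof. by exists (repr (a : Q)); rewrite /circle_pi reprK. Qed.

Lemma circle_piP x y : circle_pi x = circle_pi y <-> x - y \is a Num.int.
Proof.
rewrite -integersE Quotient.idealrBE.
by split=> [xy|/eqP//]; apply/eqP.
Qed.

Lemma circle_pi_continuous : continuous circle_pi.
Proof. exact: (@pi_continuous R Q). Qed.

Lemma circle_pi_nbhs (x : R) (U : set R) :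
  nbhs x U -> nbhs (circle_pi x) (circle_pi @` U).
Proof.
rewrite nbhsE => -[V [oV Vx] VU].
apply: (@filterS _ _ _ (circle_pi @` V)); first exact: image_subset.
apply: open_nbhs_nbhs; split; last by exists x.
suff : open (circle_pi @^-1` (circle_pi @` V)) by [].
rewrite openE => y [v Vv vy].
have : nbhs y ((fun z => z - (y - v)) @^-1` V).
  have : {for y, continuous (fun z : R => z - (y - v))}.
    by apply: cvgB; [exact: cvg_id|exact: cvg_cst].
  by apply; apply: open_nbhs_nbhs; split=> //; rewrite subKr.
apply: filterS => z Vz; exists (z - (y - v)) => //.
by rewrite !circle_piB vy subrr subr0.
Qed.

Lemma circle_sub_continuous :
  continuous (fun x : circle R * circle R => x.1 - x.2).
Proof.
move=> [a b] /= W.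
have [[x ->] [y ->]] := (circle_pi_surj a, circle_pi_surj b).
rewrite -circle_piB => /circle_pi_continuous W'.
have : nbhs (x, y) ((fun z : R * R => z.1 - z.2) @^-1` (circle_pi @^-1` W)).
  exact: (@sub_continuous R^o (x, y)).
move=> [[U1 U2] /= [U1x U2y] UW].
exists (circle_pi @` U1, circle_pi @` U2) => /=.
  by split; exact: circle_pi_nbhs.
move=> [_ _] /= [[u Uu <-] [v Uv <-]]; rewrite -circle_piB.
exact: (UW (u, v)).
Qed.

HB.instance Definition _ :=
  PreTopologicalNmodule_isTopologicalZmodule.Build (circle R)
    circle_sub_continuous.

End Circle.

Definition torus (R : realType) (n : nat) : Type := 'rV[circle R]_n.

Section Torus.
Context {R : realType} {n : nat}.

HB.instance Definition _ := Topological.copy (torus R n) 'rV[circle R]_n.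
HB.instance Definition _ := GRing.Zmodule.copy (torus R n) 'rV[circle R]_n.

Lemma torus_sub_continuous :
  continuous (fun x : torus R n * torus R n => x.1 - x.2).
Proof.
move=> [a b] /= W [P Pab PW].
have /choice[V VP] (ij : 'I_1 * 'I_n) : exists V : set (circle R) * set (circle R),
    [/\ nbhs ((a : 'rV__) ij.1 ij.2) V.1, nbhs ((b : 'rV__) ij.1 ij.2) V.2 &
        forall u v, V.1 u -> V.2 v -> P ij.1 ij.2 (u - v)].
  case: ij => i j /=; have := Pab i j; rewrite !mxE => Pij.
  have [[V1 V2] [/= V1a V2b] VP] := @circle_sub_continuous R (_, _) _ Pij.
  by exists (V1, V2); split=> // u v V1u V2v; exact: (VP (u, v)).
exists ([set M : torus R n | forall i j, (V (i, j)).1 ((M : 'rV__) i j)],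
        [set M : torus R n | forall i j, (V (i, j)).2 ((M : 'rV__) i j)]) => /=.
  split; [exists (fun i j => (V (i, j)).1)|exists (fun i j => (V (i, j)).2)] => //.
    by move=> i j; case: (VP (i, j)).
  by move=> i j; case: (VP (i, j)).
move=> [M N] [/= VM VN]; apply: PW => i j; rewrite !mxE.
by case: (VP (i, j)) => _ _; apply; [exact: VM|exact: VN].
Qed.

HB.instance Definition _ :=
  PreTopologicalNmodule_isTopologicalZmodule.Build (torus R n)
    torus_sub_continuous.

End Torus.

Definition homeo (T : topologicalType) : set (T -> T) :=
  [set f | continuous f /\
           exists g : T -> T, [/\ continuous g, cancel f g & cancel g f]].

Section AffineMaps.
Variable G : topologicalZmodType.

Definition translation (x : G) : G -> G := fun y => x + y.

Definition aut : set (G -> G) :=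
  [set f | homeo f /\ {morph f : x y / x + y}].

Definition affine_maps : set (G -> G) :=
  [set f | exists x, exists2 phi, aut phi & f = translation x \o phi].

Definition normalizer (P : set (G -> G)) : set (G -> G) :=
  [set f | homeo f /\ [set f \o p | p in P] `<=` [set p \o f | p in P]].

Definition translation_normalizer (P : set (G -> G)) : set (G -> G) :=
  [set f | homeo f /\
           forall x, exists2 p, P p & f \o translation x = p \o f].

End AffineMaps.

Arguments affine_maps G : clear implicits.

(* Main.v *)
From HB Require Import structures.
Require Import Defs.
From mathcomp Require Import all_boot all_order all_algebra.
From mathcomp Require Import all_classical all_reals topology normedtype.
From mathcomp Require Import lra.

Set Implicit Arguments.
Unset Strict Implicit.
Unset Printing Implicit Defensive.

Import Order.TTheory GRing.Theory Num.Theory.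
Import numFieldNormedType.Exports.

Local Open Scope classical_set_scope.
Local Open Scope ring_scope.

(** Affine homeomorphisms form a group under composition, so each of them
normalizes that group; and since translations are affine, a homeomorphism that
normalizes the affine maps lies in their translation normalizer.  All the
content is in the remaining inclusion: if [f] is a homeomorphism and every
[f \o translation x] equals [p_x \o f] for an affine [p_x], then [f] is affine.

Write [p_x] as a translation followed by an automorphism [phi_x], and let
[h := f - f 0].  Evaluating the hypothesis at [y] and at [0] gives
<< h (x + y) = h x + phi_x (h y) >>
so it suffices that every [phi_x] is the identity, because [h] is then additive.
Solving for [phi_x], that is << phi_x z = f (x + f^-1 (z + f 0)) - f x >>, shows
that [phi_x z] is jointly continuous in [(x, z)], and [phi_0] is the identity.

The argument now works in every compact abelian group which has no small
subgroups and in which every subgroup that is a neighbourhood of [0] is the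
whole group.  The values [phi_x z - z], with [x] fixed, form a subgroup.  By
compactness in [z] this subgroup lies in any prescribed neighbourhood of [0]
once [x] is close to [0] ([cocycle_trivial_near0]); as there are no small
subgroups, it is trivial, so [phi_x] is the identity for [x] near [0].  Those
[x] such that [h (x + y) = h x + h y] for all [y] form a subgroup
([additivity_subgroup]), which is thus a neighbourhood of [0], hence everything
([translation_normalizer_affine]).

The torus has the three properties ([torus_compact],
[torus_no_small_subgroups], [torus_nbhs_subgroup]), which are read off from the
quotient map from R^n. *)

(** * Affine maps and their normalizers in a topological abelian group *)

Lemma homeo_comp (T : topologicalType) (f g : T -> T) :
  homeo f -> homeo g -> homeo (f \o g).
Proof.
move=> [cf [f' [cf' fK f'K]]] [cg [g' [cg' gK g'K]]]; split.
  by move=> x; apply: continuous_comp; [exact: cg|exact: cf].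
exists (g' \o f'); split; last 2 first.
- exact: can_comp.
- exact: can_comp.
- by move=> x; apply: continuous_comp; [exact: cf'|exact: cg'].
Qed.

Section AffineGroup.
Variable G : topologicalZmodType.

Definition subgroup (H : set G) :=
  H 0 /\ forall x y, H x -> H y -> H (x - y).

Definition no_small_subgroups :=
  exists2 W : set G, nbhs 0 W &
    forall H, subgroup H -> H `<=` W -> H `<=` [set 0].

Lemma subgroupMn (H : set G) (x : G) (m : nat) :
  subgroup H -> H x -> H (x *+ m).
Proof.
move=> [H0 Hsub] Hx; elim: m => // m IH; rewrite mulrSr -[x in _ + x]opprK.
by apply: (Hsub) => //; rewrite -sub0r; exact: Hsub.
Qed.

Lemma zmod_cvgD (T : Type) (F : set_system T) (f g : T -> G) (a b : G)
    {FF : Filter F} :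
  f @ F --> a -> g @ F --> b -> (fun x => f x + g x) @ F --> a + b.
Proof.
apply: (@continuous2_cvg _ _ _ _ _ _ _ _ +%R).
exact: (@add_continuous _ (a, b)).
Qed.

Lemma zmod_cvgB (T : Type) (F : set_system T) (f g : T -> G) (a b : G)
    {FF : Filter F} :
  f @ F --> a -> g @ F --> b -> (fun x => f x - g x) @ F --> a - b.
Proof.
apply: (@continuous2_cvg _ _ _ _ _ _ _ _ (fun u v : G => u - v)).
exact: (@sub_continuous _ (a, b)).
Qed.

Lemma translation_continuous (x : G) : continuous (translation x).
Proof. by move=> y; apply: zmod_cvgD; [exact: cvg_cst|exact: cvg_id]. Qed.

Lemma homeo_translation (x : G) : homeo (translation x).
Proof.
split; first exact: translation_continuous.
exists (translation (- x)); split; first exact: translation_continuous.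
- exact: addKr.
- exact: addNKr.
Qed.

Lemma aut_id : aut (id : G -> G).
Proof.
have cid : continuous (id : G -> G) by move=> x; exact: cvg_id.
by split=> //; split=> //; exists id.
Qed.

Lemma translation_affine (x : G) : affine_maps G (translation x).
Proof. by exists x, id => //; exact: aut_id. Qed.

Lemma affine_homeo (f : G -> G) : affine_maps G f -> homeo f.
Proof.
move=> [x [phi [hphi _] ->]].
by apply: homeo_comp => //; exact: homeo_translation.
Qed.

Lemma affine_comp (f g : G -> G) :
  affine_maps G f -> affine_maps G g -> affine_maps G (f \o g).
Proof.
move=> [x [phi [hphi phiD] ->]] [y [psi [hpsi psiD] ->]].
exists (x + phi y), (phi \o psi).
  by split; [exact: homeo_comp|move=> u v /=; rewrite psiD phiD].
by apply/funext => u; rewrite /translation /= phiD addrA.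
Qed.

Lemma affine_inverse (f : G -> G) : affine_maps G f ->
  exists g, [/\ affine_maps G g, cancel f g & cancel g f].
Proof.
move=> [x [phi [[cphi [psi [cpsi phiK psiK]]] phiD] ->]].
have psiD : {morph psi : u v / u + v}.
  by move=> u v; apply: (can_inj phiK); rewrite phiD !psiK.
exists (psi \o translation (- x)); split.
- apply: affine_comp (translation_affine _).
  exists 0, psi; last by apply/funext => u; rewrite /translation /= add0r.
  by split=> //; split=> //; exists phi.
- by move=> u; rewrite /translation /= addKr phiK.
- by move=> u; rewrite /translation /= psiK addNKr.
Qed.

(** For [f] and [p] affine, [f \o p = (f \o p \o f^-1) \o f]. *)
Lemma affine_sub_normalizer :
  affine_maps G `<=` normalizer (affine_maps G).
Proof.
move=> f af; split; first exact: affine_homeo.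
move=> _ [p ap <-]; have [g [ag fK gK]] := affine_inverse af.
exists (f \o (p \o g)); first by do 2 apply: affine_comp => //.
by apply/funext => u /=; rewrite fK.
Qed.

Lemma normalizer_sub_translation_normalizer (P : set (G -> G)) :
  (forall x, P (translation x)) -> normalizer P `<=` translation_normalizer P.
Proof.
move=> Ptr f [hf fP]; split=> // x.
have [|p Pp pf] := fP (f \o translation x); first by exists (translation x).
by exists p.
Qed.

(** * Homeomorphisms that turn translations into affine maps *)

(** The map in the conclusion is the automorphism part [phi_x] of the affine map
attached to [x].  It is written through [f] and its inverse [g], so that no
choice of [phi_x] is needed and its continuity in [x] is visible. *)
Lemma translation_normalizer_cocycle (f g : G -> G) :
  translation_normalizer (affine_maps G) f -> cancel g f ->
  forall x, {morph (fun z => f (x + g (z + f 0)) - f x) : u v / u + v}.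
Proof.
move=> [_ fE] gK x u v; have [p [a [phi [_ phiD] ->]] fp] := fE x.
have E y : f (x + y) = a + phi (f y) by have := congr1 (@^~ y) fp.
have E0 : f x = a + phi (f 0) by rewrite -E addr0.
have EE w : f (x + g (w + f 0)) - f x = phi w.
  by rewrite E gK phiD E0 addrCA addrK.
by rewrite !EE.
Qed.

(** The defect [phi_x z - z] is continuous in [(x, z)] and vanishes at [x = 0],
so by the tube lemma it is uniformly small in [z] for [x] near [0]; its values
form a subgroup because [phi_x] is additive. *)
Lemma cocycle_trivial_near0 (f g : G -> G) :
  compact [set: G] ->
  no_small_subgroups ->
  continuous f -> continuous g -> cancel g f -> cancel f g ->
  (forall x, {morph (fun z => f (x + g (z + f 0)) - f x) : u v / u + v}) ->
  \forall x \near (0 : G), forall z, f (x + g (z + f 0)) - f x = z.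
Proof.
move=> cG [W W0 nssW] cf cg gK fK phiD.
pose d x z := (f (x + g (z + f 0)) - f x) - z.
have d0 z : d 0 z = 0 by rewrite /d add0r gK addrK subrr.
have cd (z : G) : d p.1 p.2 @[p --> ((0 : G), z)] --> (0 : G).
  rewrite -[X in _ --> X](d0 z); apply: zmod_cvgB; last exact: cvg_snd.
  apply: zmod_cvgB.
    apply: continuous_cvg; first exact: cf.
    apply: zmod_cvgD; first exact: cvg_fst.
    apply: continuous_cvg; first exact: cg.
    by apply: zmod_cvgD; [exact: cvg_snd|exact: cvg_cst].
  by apply: continuous_cvg; [exact: cf|exact: cvg_fst].
(* Compactness in the form of [near_covering] is the tube lemma. *)
have : \forall x \near (0 : G), [set: G] `<=` [set z | W (d x z)].
  move/compact_near_coveringP: cG; apply => z _.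
  have [[A B] /= [A0 Bz] AB] := cd z W W0.
  by exists (B, A) => //= -[u v] /= [Bu Av]; exact: (AB (v, u)).
apply: filterS => x dW z; apply/eqP; rewrite -subr_eq0; apply/eqP.
apply: (nssW [set d x u | u in [set: G]]); last by exists z.
- have dB u v : d x (u - v) = d x u - d x v.
    apply/eqP; rewrite eq_sym subr_eq -[X in d x X == _](subrK v u).
    by apply/eqP; rewrite {1 2 3}/d phiD opprD addrACA.
  split; first by exists 0 => //; rewrite -[X in d x X](subrr (0 : G)) dB subrr.
  by move=> _ _ [u _ <-] [v _ <-]; exists (u - v).
- by move=> _ [u _ <-]; exact: dW.
Qed.

(** Additivity at [x'], applied to [z - x'], gives [h (z - x') = h z - h x'] for
all [z]; closure under differences uses it for [z = x] and [z = y]. *)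
Lemma additivity_subgroup (h : G -> G) : h 0 = 0 ->
  subgroup [set x | forall y, h (x + y) = h x + h y].
Proof.
move=> h0; split=> [y|x x' hx hx' y] /=; first by rewrite h0 !add0r.
have hB z : h (z - x') = h z - h x'.
  by apply/eqP; rewrite eq_sym subr_eq addrC -hx' addrCA subrr addr0.
by rewrite hB -addrAC hB hx addrAC.
Qed.

(** The last hypothesis on [G] follows from connectedness, since a subgroup that
is a neighbourhood of [0] is open and closed. *)
Lemma translation_normalizer_affine :
  compact [set: G] ->
  no_small_subgroups ->
  (forall H : set G, subgroup H -> nbhs 0 H -> H = setT) ->
  translation_normalizer (affine_maps G) `<=` affine_maps G.
Proof.
move=> cG nss conn f ef; have [[cf [g [cg fK gK]]] _] := ef.
have phiD := translation_normalizer_cocycle ef gK.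
have phi1 := cocycle_trivial_near0 cG nss cf cg gK fK phiD.
pose h := translation (- f 0) \o f.
have h0 : h 0 = 0 by rewrite /h /translation /= addNr.
have hD : {morph h : x y / x + y}.
  suff hT : [set x | forall y, h (x + y) = h x + h y] = setT.
    by move=> x y; have : setT x by []; rewrite -hT; exact.
  apply: conn; first exact: additivity_subgroup.
  apply: filterS phi1 => x phi1 y; rewrite /h /translation /=.
  have := phi1 (f y - f 0); rewrite subrK fK => /eqP.
  rewrite subr_eq => /eqP ->.
  by rewrite [f y - f 0 + _]addrC [- f 0 + f y]addrC addrA.
exists (f 0), h; last first.
  by apply/funext => u; rewrite /h /translation /= addrA addrN add0r.
split=> //; apply: homeo_comp; first exact: homeo_translation.
by split=> //; exists g.
Qed.

End AffineGroup.

(** * The torus as a compact group without small subgroups *)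

Section Torus.
Variables (R : realType) (n : nat).

HB.instance Definition _ :=
  GRing.isZmodMorphism.Build R (circle R) (@circle_pi R) (@circle_piB R).

Definition torus_pi (v : 'rV[R]_n) : torus R n := map_mx (@circle_pi R) v.

Lemma torus_piB : {morph torus_pi : u v / u - v}.
Proof. by move=> u v; apply/matrixP => i j; rewrite !mxE raddfB. Qed.

HB.instance Definition _ :=
  GRing.isZmodMorphism.Build 'rV[R]_n (torus R n) torus_pi torus_piB.

Lemma torus_pi_surj (t : torus R n) : exists v, t = torus_pi v.
Proof.
exists (\row_j projT1 (cid (circle_pi_surj ((t : 'rV__) ord0 j)))).
by apply/rowP => j; rewrite !mxE; case: cid.
Qed.

Lemma torus_pi_continuous : continuous torus_pi.
Proof.
move=> v W [P Pv PW].
exists (fun i j => circle_pi @^-1` P i j).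
  by move=> i j; apply: circle_pi_continuous; have := Pv i j; rewrite mxE.
by move=> u Pu; apply: PW => i j; rewrite mxE; exact: Pu.
Qed.

Lemma torus_compact : compact [set: torus R n].
Proof.
have -> : [set: torus R n] =
    torus_pi @` [set v : 'rV[R]_n | forall i, `[0, 1]%classic (v ord0 i)].
  apply/seteqP; split=> // t _; have [v ->] := torus_pi_surj t.
  exists (\row_j (v ord0 j - (Num.floor (v ord0 j))%:~R)).
    move=> j; rewrite /= mxE in_itv /= subr_ge0 floor_le_tmp lerBlDl.
    by rewrite ltW // -[X in _ + X]/(1%:~R) -intrD floorD1_gt.
  apply/rowP => j; rewrite !mxE; apply/circle_piP.
  by rewrite addrAC subrr add0r rpredN intr_int.
apply: continuous_compact; last first.
  apply: (@rV_compact R n (fun=> `[0, 1]%classic)) => i.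
  exact: segment_compact.
by apply: continuous_subspaceT; exact: torus_pi_continuous.
Qed.

(** The point with lift [v] is [m.+1] times the point with lift [v / m.+1], and
the latter is arbitrarily close to [0]. *)
Lemma torus_nbhs_subgroup (H : set (torus R n)) :
  subgroup H -> nbhs 0 H -> H = setT.
Proof.
move=> sH nH; apply/seteqP; split=> // t _; have [v ->] := torus_pi_surj t.
have : nbhs (0 : R) [set s | H (torus_pi (s *: v))].
  have : (fun s : R => torus_pi (s *: v)) @ (0 : R) --> torus_pi (0 *: v).
    apply: continuous_cvg; first exact: torus_pi_continuous.
    by apply: cvgZr_tmp; exact: cvg_id.
  by apply; rewrite scale0r raddf0.
move=> [e /= e0 eH].
pose m := Num.trunc e^-1.
have me : m.+1%:R^-1 < e by rewrite invf_plt ?posrE ?ltr0n // truncnS_gt.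
have -> : v = (m.+1%:R^-1 *: v) *+ m.+1.
  by rewrite -scaler_nat scalerA divff ?scale1r // pnatr_eq0.
rewrite raddfMn; apply: subgroupMn => //; apply: eH.
by rewrite /ball_ /= sub0r normrN ger0_norm ?invr_ge0 ?ler0n.
Qed.

(** If [|r m| < 1/3] then [|r (m + 1)| < 2/3], so [r (m + 1)] differs by less
than [1] from any [s] with [|s| < 1/3]; when the two agree modulo the integers
they are equal.  Hence all multiples of [r] stay below [1/3], and [r] vanishes
by the Archimedean property. *)
Lemma circle_small_multiples (r : R) : `|r| < 3^-1 ->
  (forall m, exists2 s, `|s| < 3^-1 & circle_pi (r *+ m) = circle_pi s) ->
  r = 0.
Proof.
move=> r3 rm.
have small m : `|r *+ m| < 3^-1.
  elim: m => [|m IH]; first by rewrite mulr0n normr0 invr_gt0.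
  have [s s3 /circle_piP rs] := rm m.+1.
  suff /eqP : r *+ m.+1 - s = 0 by rewrite subr_eq0 => /eqP ->.
  apply/eqP; apply: contraT => /(norm_intr_ge1 rs); rewrite leNgt => /negP[].
  apply: le_lt_trans (ler_normB _ _) _; rewrite mulrS.
  have := ler_normD r (r *+ m); lra.
apply/eqP; apply: contraT => r0.
have := small (Num.bound `|r|^-1); rewrite normrMn -mulr_natr => A.
have := archi_boundP (_ : 0 <= `|r|^-1); rewrite invr_ge0 normr_ge0 => /(_ isT).
rewrite -(ltr_pM2l (_ : 0 < `|r|)) ?normr_gt0 // divff ?normr_eq0 // => B.
move: A B; lra.
Qed.

Lemma torus_no_small_subgroups : no_small_subgroups (torus R n).
Proof.
pose U := circle_pi @` [set s : R | `|s| < 3^-1].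
exists [set t : torus R n | forall i j, U ((t : 'rV__) i j)].
  exists (fun _ _ => U) => // i j.
  rewrite mxE -(raddf0 (@circle_pi R)).
  apply: circle_pi_nbhs; apply/nbhs_ballP; exists 3^-1 => /=.
    by rewrite invr_gt0.
  by move=> s; rewrite /ball /= sub0r normrN.
move=> H sH HU t Ht; apply/matrixP => i j; have [r r3 rt] := HU t Ht i j.
suff r0 : r = 0 by rewrite mxE -rt r0 raddf0.
apply: circle_small_multiples r3 _ => m.
have [s s3 st] := HU _ (subgroupMn m sH Ht) i j; exists s => //.
by rewrite st mulmxnE -rt raddfMn.
Qed.

End Torus.

Theorem theorem3p2p1 (R : realType) (n : nat) :
  affine_maps (torus R n) = normalizer (affine_maps (torus R n)) /\
  normalizer (affine_maps (torus R n)) =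
    translation_normalizer (affine_maps (torus R n)).
Proof.
have AN := @affine_sub_normalizer (torus R n).
have NE :=
  normalizer_sub_translation_normalizer (@translation_affine (torus R n)).
have EA := translation_normalizer_affine (@torus_compact R n)
  (@torus_no_small_subgroups R n) (@torus_nbhs_subgroup R n).
split; apply/seteqP; split=> // f Pf; first exact/EA/NE.
exact/AN/EA.
Qed.
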